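(* Let $u$ be an upcycle with diamondicity $d=1$ for $A^n$, where $A=\mathbb{F}_{p^k}$ is the finite field with $p^k$ elements, $p$ prime. Then no De Bruijn lift of $u$ can be obtained by a linear feedback shift register (LFSR).
   Context: Let $A$ be an alphabet with $a=|A|\ge 2$ letters and $\diamond\notin A$ a wildcard symbol (''diamond''). A partial word is a finite sequence over $A\cup\{\diamond\}$; a cyclic partial word $u=(u_1\cdots u_N)$ is cyclically ordered, with indices taken modulo $N$. A partial word $x$ covers a partial word $y$ of the same length if for each $i$ either $x_i=\diamond$ or $x_i=y_i$; a cyclic partial word covers a cyclic partial word of the same length if this holds for a suitable alignment (rotation). For $n\ge 1$, an upcycle for $A^n$ is a cyclic partial word $u=(u_1\cdots u_N)$ such that for each word $y\in A^n$ there is exactly one position $i\in\{1,\dots,N\}$ such that the window $u_i\cdots u_{i+n-1}$ covers $y$. It is known that the diamonds of an upcycle are $n$-periodic, so all windows contain the same number $d$ of diamonds, called the diamondicity; then $u$ has length $a^{n-d}$. A De Bruijn cycle for $A^n$ is an upcycle for $A^n$ with no diamonds. $u^{(q)}$ denotes the cyclic concatenation of $q$ copies of $u$. A De Bruijn lift of an upcycle $u$ for $A^n$ with diamondicity $d\ge 1$ is a De Bruijn cycle $w$ for $A^n$ that is covered by $u^{(a^d)}$. Given a De Bruijn cycle $w$ for $A^n$ with $A=\mathbb{F}_{p^k}$, the modified De Bruijn cycle $\widehat{w}$ is the cyclic word of length $a^n-1$ obtained from $w$ by deleting one $0$ from the unique occurrence of $0^n$ in $w$. A De Bruijn cycle $w$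 for $A^n$ is said to be obtained (generated) by an LFSR if $\widehat{w}=(s_1\cdots s_{a^n-1})$ can be generated by an LFSR, in the standard sense of an $n$-stage linear feedback shift register over $\mathbb{F}_{p^k}$: there are $c_0,\dots,c_{n-1}\in\mathbb{F}_{p^k}$ with $s_{i+n}=\sum_{j=0}^{n-1}c_js_{i+j}$ for all $i$ (indices modulo $a^n-1$).
   Formalization: The formal theorem assumes n ≥ 2. For n = 1 the claim is false: u = (◇) has the De Bruijn lift (0, 1, g, …, g^{a−2}), with g a generator of the nonzero elements of A, and this lift is obtained by the LFSR s_{i+1} = g s_i. *)

(* Defs.v *)
From mathcomp Require Import all_boot all_algebra.

Set Implicit Arguments.
Unset Strict Implicit.
Unset Printing Implicit Defensive.

Import GRing.Theory.

(* [None] is the diamond; a word over A without diamonds is a [seq A], viewed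
   as a partial word through [map Some]. Cyclic words are sequences read with
   indices modulo their size, hence considered up to [rot]. *)
Definition pword (A : Type) := seq (option A).

Definition cyc (T : Type) (x0 : T) (s : seq T) (i : nat) : T :=
  nth x0 s (i %% size s).

Definition window (T : Type) (x0 : T) (n : nat) (s : seq T) (i : nat) : seq T :=
  mkseq (fun j => cyc x0 s (i + j)) n.

(* [all2] is false on sequences of different sizes. *)
Definition covers (A : eqType) (x y : pword A) : bool :=
  all2 (fun a b => (a == None) || (a == b)) x y.

Definition cyc_covers (A : eqType) (x y : pword A) : Prop :=
  exists r : nat, covers x (rot r y).

Definition upcycle (A : finType) (n : nat) (u : pword A) : Prop :=
  forall y : n.-tuple A,
    exists! i : 'I_(size u), covers (window None n u i) (map Some y).

Definition has_diamondicity (A : finType) (n : nat) (u : pword A) (d : nat) :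
    Prop :=
  forall i : 'I_(size u), count_mem None (window None n u i) = d.

Definition debruijn (A : finType) (n : nat) (w : seq A) : Prop :=
  upcycle n (map Some w).

Definition cyc_pow (T : Type) (q : nat) (u : seq T) : seq T :=
  flatten (nseq q u).

Definition debruijn_lift (A : finType) (n d : nat) (u : pword A) (w : seq A) :
    Prop :=
  debruijn n w /\ cyc_covers (cyc_pow (#|A| ^ d) u) (map Some w).

Definition zero_run (F : finFieldType) (n : nat) (w : seq F) : nat :=
  find (fun i => window 0%R n w i == nseq n 0%R) (iota 0 (size w)).

(* Deletes the first 0 of the occurrence of 0^n; deleting another 0 of that
   occurrence gives a rotation of the same word. *)
Definition modified (F : finFieldType) (n : nat) (w : seq F) : seq F :=
  take (zero_run n w) w ++ drop (zero_run n w).+1 w.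

Definition generated_by_LFSR (F : finFieldType) (n : nat) (s : seq F) : Prop :=
  exists c : 'I_n -> F, forall i : nat,
    cyc 0%R s (i + n) = (\sum_(j < n) c j * cyc 0 s (i + j)%N)%R.

Definition obtained_by_LFSR (F : finFieldType) (n : nat) (w : seq F) : Prop :=
  generated_by_LFSR n (modified n w).

(* Main.v *)
(* Let V be the lift read just after its occurrence of 0^n, and let N be the
   length of u. The difference V (i + N) - V i is nonzero exactly at the
   diamonds, i.e. at one residue class of indices modulo n. Where V obeys the
   recurrence, so does this difference, and comparing coefficients leaves only
   the term c_0. Then V is supported, outside of 0^n, on one residue class
   modulo n, so the word 11...1 cannot occur. The range on which the recurrence
   is known is too short for this argument only when |F| = 2 and n <= 4; there
   n = 3 fails because n divides N, and n = 2, 4 are checked by hand. *)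
Require Import Defs.
From mathcomp Require Import all_boot all_algebra.
From mathcomp Require Import zify.

Set Implicit Arguments.
Unset Strict Implicit.
Unset Printing Implicit Defensive.

Import GRing.Theory.

(** * Cyclic indexing, windows and covering *)

Lemma cyc_modn (T : Type) (x0 : T) (s : seq T) (i : nat) :
  cyc x0 s (i %% size s) = cyc x0 s i.
Proof. by rewrite /cyc modn_mod. Qed.

Lemma cycDsize (T : Type) (x0 : T) (s : seq T) (i : nat) :
  cyc x0 s (i + size s) = cyc x0 s i.
Proof. by rewrite /cyc modnDr. Qed.

Lemma cyc_map (T U : Type) (x0 : T) (y0 : U) (f : T -> U) (s : seq T)
    (i : nat) :
  0 < size s -> cyc y0 (map f s) i = f (cyc x0 s i).
Proof. by move=> s0; rewrite /cyc size_map (nth_map x0) // ltn_mod. Qed.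

Lemma cyc_rot (T : Type) (x0 : T) (r : nat) (s : seq T) (i : nat) :
  r <= size s -> cyc x0 (rot r s) i = cyc x0 s (i + r).
Proof.
rewrite /cyc size_rot => ler; case: (posnP (size s)) => [/size0nil ->|s0].
  by rewrite !nth_nil.
have := ltn_pmod i s0; set j := i %% _ => ltj.
rewrite /rot nth_cat size_drop nth_drop -modnDml -/j.
case: ltnP => hj; first by rewrite addnC modn_small //; lia.
rewrite nth_take; last by lia.
rewrite (_ : j + r = j - (size s - r) + size s); last by lia.
by rewrite modnDr modn_small //; lia.
Qed.

Lemma size_cyc_pow (T : Type) (q : nat) (u : seq T) :
  size (cyc_pow q u) = q * size u.
Proof. by rewrite size_flatten /shape map_nseq sumn_nseq mulnC. Qed.

Lemma cyc_cyc_pow (T : Type) (x0 : T) (q : nat) (u : seq T) (i : nat) :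
  0 < q -> cyc x0 (cyc_pow q u) i = cyc x0 u i.
Proof.
move=> q0; rewrite {1}/cyc size_cyc_pow.
case: (posnP (size u)) => [u0|u0].
  by rewrite nth_default ?size_cyc_pow /cyc ?u0 ?muln0 // nth_default ?u0.
rewrite -[RHS]cyc_modn -(@modn_dvdm (q * size u) i (size u)) ?dvdn_mull //.
rewrite cyc_modn.
have {q0}: i %% (q * size u) < q * size u by rewrite ltn_pmod // muln_gt0 q0.
elim: q (i %% _) => // q IHq j.
rewrite mulSn /cyc_pow /= nth_cat => ltj; case: ltnP => hj.
  by rewrite /cyc modn_small.
by rewrite IHq ?ltn_subLR // -cycDsize subnK.
Qed.

Lemma window_eqP (T : Type) (x0 : T) (n : nat) (s t : seq T) (i j : nat) :
  (forall k, k < n -> cyc x0 s (i + k) = cyc x0 t (j + k)) <->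
  window x0 n s i = window x0 n t j.
Proof.
split=> [E|E k ltk].
  by apply/eq_in_map => k; rewrite mem_iota => ltk; apply: E.
by rewrite -(nth_mkseq x0 (fun k => cyc x0 s (i + k)) ltk) -/(window _ _ _ _)
  E nth_mkseq.
Qed.

Lemma window_modn (T : Type) (x0 : T) (n : nat) (s : seq T) (i : nat) :
  window x0 n s (i %% size s) = window x0 n s i.
Proof. by apply/window_eqP => k _; rewrite /cyc modnDml. Qed.

Lemma covers_map_Some (A : eqType) (s t : seq A) :
  covers (map Some s) (map Some t) = (s == t).
Proof. by elim: s t => [|x s IHs] [|y t] //=; rewrite IHs. Qed.

Lemma coversP (A : eqType) (x y : pword A) : covers x y ->
  size x = size y /\
  forall i, nth None x i = None \/ nth None x i = nth None y i.
Proof.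
elim: x y => [|a x IHx] [|b y] //= => [_|/andP[ab /IHx[-> E]]].
  by split=> // i; left; rewrite nth_nil.
by split=> // -[|i] //=; case/orP: ab => /eqP; [left | right].
Qed.

(** * De Bruijn cycles and the deleted zero *)

(** Sending a position to its window is a bijection onto the [n]-tuples. Its surjectivity,
    injectivity and cardinality are recorded in terms of [cyc], free of ordinals and tuples. *)
Lemma debruijnP (F : finFieldType) (n : nat) (w : seq F) : debruijn n w ->
  [/\ forall y : nat -> F, exists2 i, i < size w &
        forall k, k < n -> cyc 0%R w (i + k) = y k,
      forall i j, window 0%R n w i = window 0%R n w j -> i = j %[mod size w]
    & size w = #|F| ^ n].
Proof.
move=> dbw; have w0 : 0 < size w.
  have [i _] := dbw (nseq_tuple n 0%R).
  by rewrite -(size_map Some); apply: leq_ltn_trans (ltn_ord i).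
have mapw i (y : n.-tuple F) :
      covers (window None n (map Some w) i) (map Some y) =
      (window 0%R n w i == y).
  rewrite -covers_map_Some /window /mkseq -map_comp; congr (covers _ _).
  by apply/eq_map => k; rewrite (cyc_map 0%R).
have wsz i : size (window 0%R n w i) == n by rewrite size_mkseq.
pose f (i : 'I_(size w)) : n.-tuple F := Tuple (wsz i).
have ex (y : n.-tuple F) : exists i, f i = y.
  have [[i lti] [/= cov _]] := dbw y; rewrite mapw in cov.
  have lti' : i < size w by rewrite -(size_map Some).
  by exists (Ordinal lti'); apply/val_inj/eqP.
have f_inj : injective f.
  move=> i j fij; have [l [_ l_uniq]] := dbw (f i).
  have lt (k : 'I_(size w)) : k < size (map Some w) by rewrite size_map.
  have := l_uniq (Ordinal (lt i)); rewrite mapw => /(_ (eqxx _)) li.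
  have := l_uniq (Ordinal (lt j)); rewrite mapw fij => /(_ (eqxx _)) lj.
  by apply: val_inj; move: li; rewrite lj => -[].
split.
- move=> y; have ysz : size (mkseq y n) == n by rewrite size_mkseq.
  have [i fi] := ex (Tuple ysz); exists (val i) => [|k ltk].
    exact: ltn_ord.
  have /(congr1 (fun t : n.-tuple F => nth 0%R t k)) := fi.
  by rewrite /= !nth_mkseq.
- move=> i j; rewrite -window_modn -[RHS]window_modn => E.
  have lt k : k %% size w < size w by rewrite ltn_pmod.
  have /f_inj : f (Ordinal (lt i)) = f (Ordinal (lt j)) by apply: val_inj.
  by case.
- rewrite -card_tuple -[LHS]card_ord; apply: bij_eq_card (f) _.
  have f_codom y : y \in codom f by have [i <-] := ex y; apply: codom_f.
  by exists (fun y => iinv (f_codom y)) => y; [apply: f_inj|]; rewrite f_iinv.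
Qed.

Lemma size_modified (F : finFieldType) (n : nat) (w : seq F) :
  zero_run n w < size w -> size (modified n w) = (size w).-1.
Proof. by move=> ltz; rewrite size_cat size_take size_drop ltz; lia. Qed.

(** Deleting one letter shifts all later letters by one. At [i = (size w).-1] the modified word is
    back at its starting point, while [w] reads the deleted letter. *)
Lemma cyc_modified (F : finFieldType) (n : nat) (w : seq F) (i : nat) :
  zero_run n w < size w -> i < (size w).-1 ->
  cyc 0%R (modified n w) (zero_run n w + i) = cyc 0%R w ((zero_run n w).+1 + i).
Proof.
move=> ltz lti; rewrite /cyc size_modified // /modified; move: ltz lti.
move: (zero_run n w) => z; rewrite nth_cat size_take => ltz; rewrite ltz.
have := prednK (leq_ltn_trans (leq0n z) ltz); move: ltz.
move: (size w).-1 => m; move: (size w) => N ltz defN; rewrite -defN in ltz *.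
move=> lti.
case: (ltnP (z + i) m) => hzi.
  by rewrite !modn_small ?addSn // ltnNge leq_addr nth_drop addKn.
have -> : (z + i) %% m = z + i - m.
  by rewrite -{1}(subnK hzi) modnDr modn_small //; lia.
have -> : (z.+1 + i) %% m.+1 = z + i - m.
  rewrite (_ : z.+1 + i = z + i - m + m.+1); last by lia.
  by rewrite modnDr modn_small //; lia.
by rewrite ifT ?nth_take //; lia.
Qed.

(** * Positions of the diamonds *)

Definition one_per_window (n : nat) (P : pred nat) : Prop :=
  forall i, \sum_(0 <= j < n) P (i + j) = 1.

(** The windows at [i] and [i.+1] share all but their extreme positions, so equal counts force
    [P (i + n) = P i]. One period then contains a single position [e]. *)
Lemma one_per_windowP (n : nat) (P : pred nat) : one_per_window n P ->
  exists2 e, e < n & forall i, P i = (i %% n == e).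
Proof.
move=> P1; have Pn i : P (i + n) = P i.
  have := erefl (\sum_(0 <= j < n.+1) P (i + j)).
  rewrite {1}big_nat_recr //= big_nat_recl //= P1 addn0.
  under [X in _ = _ + X -> _]eq_bigr do rewrite addnS -addSn.
  by rewrite P1 addnC => /addIn; case: (P _); case: (P _).
have n0 : 0 < n by case: n P1 {Pn} => // /(_ 0); rewrite big_nil.
have Pmod i : P i = P (i %% n).
  rewrite {1}(divn_eq i n); elim: (i %/ n) => // q IHq.
  by rewrite mulSn -addnA addnC Pn.
have := P1 0; rewrite big_mkord => Psum.
have [e Pe|P0] := pickP (fun j : 'I_n => P j); last first.
  by move: Psum; rewrite big1 // => j _; rewrite add0n P0.
exists (val e) => [|i]; first exact: ltn_ord.
rewrite Pmod; move: Psum; rewrite (bigD1 e) //= add0n Pe => /(@addnI 1 _ 0).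
move=> /eqP; rewrite sum_nat_eq0 => /forallP/(_ (Ordinal (ltn_pmod i n0))) /=.
rewrite -(inj_eq val_inj) /= add0n.
by case: eqP => [-> _|_ /=]; [rewrite Pe | case: (P _)].
Qed.

Lemma diamond_one_per_window (A : finType) (n : nat) (u : pword A) :
  0 < size u -> has_diamondicity n u 1 ->
  one_per_window n (fun i => cyc None u i == None).
Proof.
move=> u0 d1 i; rewrite -[RHS](d1 (Ordinal (ltn_pmod i u0))) /= window_modn.
rewrite count_map -sum1_count [RHS]big_mkcond /index_iota subn0.
by apply: eq_bigr => j _ /=; case: eqP.
Qed.

Lemma cyc_coversP (A : eqType) (x0 : A) (q : nat) (u : pword A) (w : seq A) :
  0 < q -> 0 < size w -> cyc_covers (cyc_pow q u) (map Some w) ->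
  size w = q * size u /\
  exists r, forall i, cyc None u (i + r) = None \/
                      cyc None u (i + r) = Some (cyc x0 w i).
Proof.
move=> q0 w0 [r]; wlog lerw : r / r <= size w => [wl|/coversP[sz cov]].
  (* Beyond the size, [rot] is the identity, so the rotation by 0 serves instead. *)
  have [/wl //|lew] := leqP r (size w);
  rewrite rot_oversize ?size_map 1?ltnW //.
  by rewrite -[map Some w]rot0; apply: wl.
have {}cov i : cyc None (cyc_pow q u) i = None \/
    cyc None (cyc_pow q u) i = cyc None (rot r (map Some w)) i.
  by rewrite /cyc -sz; apply: cov.
split; first by rewrite -size_cyc_pow sz size_rot size_map.
(* The shift [size w - r] undoes the rotation by [r]. *)
exists (size w - r) => i; have := cov (i + (size w - r)).
rewrite cyc_rot ?size_map // -addnA subnK // (cyc_map x0) // cycDsize.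
by rewrite cyc_cyc_pow.
Qed.

Local Open Scope ring_scope.

(** * Recurrences and sparse differences *)

(** The recurrence reduces to multiplication of [V i] by the coefficient at 0, so a nonzero value at
    [i >= n] comes from one at [i - n]. Descent ends at [n.-1], the only index below [n] where [V]
    may be nonzero. *)
Lemma LFSR_sparse_support (F : finFieldType) (n M : nat) (V : nat -> F)
    (c : 'I_n -> F) : (1 < n)%N ->
  (forall i, (i < n.-1)%N -> V i = 0) ->
  (forall i : 'I_n, (0 < i)%N -> c i = 0) ->
  (forall i, (i + n < M)%N -> V (i + n)%N = \sum_(j < n) c j * V (i + j)%N) ->
  forall i, (i < M)%N -> V i != 0 -> (i %% n = n.-1)%N.
Proof.
move=> n1 V0 c0 rec; elim/ltn_ind => i IHi ltiM.
have [ltin|leni] := ltnP i n.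
  rewrite modn_small // => Vi; apply/eqP; rewrite eqn_leq -ltnS prednK;
    last by lia.
  by rewrite ltin leqNgt; apply: contraNN Vi => /V0 ->.
rewrite -{2}(subnK leni) modnDr -{1}(subnK leni) rec ?subnK //.
rewrite (bigD1 (Ordinal (ltnW n1))) //= big1 => [|j j0].
  rewrite addr0 addn0 mulf_eq0 negb_or => /andP[_].
  by apply: IHi; lia.
by rewrite c0 ?mul0r // lt0n; apply: contraNneq j0 => j0; apply/eqP/val_inj.
Qed.

(** Subtract the recurrences at [j] and [j + N], where [j + i] lies in the class [e]. Only the term
    of [c i] survives on the right, and the left side vanishes because [j + n] is outside the class
    when [0 < i < n]. As [j < n], the bound on [M] makes both recurrences available. *)
Lemma LFSR_coef_eq0 (F : finFieldType) (n N M e : nat) (V : nat -> F)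
    (c : 'I_n -> F) : (e < n)%N -> (N + 2 * n <= M)%N ->
  (forall i, (V (i + N)%N != V i) = (i %% n == e)%N) ->
  (forall i, (i + n < M)%N -> V (i + n)%N = \sum_(j < n) c j * V (i + j)%N) ->
  forall i : 'I_n, (0 < i)%N -> c i = 0.
Proof.
move=> lten NM VN rec i i0; have n0 := leq_ltn_trans (leq0n e) lten.
have ltin := ltn_ord i.
pose j := ((e + (n - i)) %% n)%N; have ltjn : (j < n)%N by rewrite ltn_pmod.
have ji : ((j + i) %% n = e)%N.
  by rewrite modnDml -addnA subnK ?modnDr ?modn_small // ltnW.
have Vjn : V (j + n + N)%N = V (j + n)%N.
  apply/eqP; rewrite -[_ == _]negbK VN modnDr modn_small //.
  rewrite -ji -{1}(modn_small ltjn) -{1}[j]addn0 eqn_modDl mod0n.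
  by rewrite modn_small // eq_sym -lt0n i0.
move: Vjn; rewrite addnAC !rec; [|lia|lia].
move/eqP; rewrite -subr_eq0 -sumrB (bigD1 i) //= big1 => [|l li].
  rewrite addr0 -mulrBr mulf_eq0 subr_eq0 addnAC -[X in _ || X]negbK VN ji eqxx.
  by rewrite orbF => /eqP.
rewrite -mulrBr addnAC; apply/eqP; rewrite mulf_eq0 subr_eq0.
rewrite -[X in _ || X]negbK VN -ji eqn_modDl !modn_small //.
by rewrite orbC; move: li; rewrite -(inj_eq val_inj) => ->.
Qed.

(** * The small cases over the field with two elements *)

Lemma card2_addr_neq0 (F : finFieldType) (x y : F) : #|F| = 2%N ->
  (x + y != 0) = (x != 0) (+) (y != 0).
Proof.
move=> F2; have eq1 z : z != 0 :> F -> z = 1.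
  move=> z0; apply/eqP; apply: contraT => z1.
  (* A third value would give a subset with three elements. *)
  have := max_card [set 0; 1; z].
  by rewrite setUC cardsU1 cards2 !inE negb_or z0 z1 eq_sym oner_eq0 F2.
have [->|/eq1 ->] := eqVneq x 0; first by rewrite add0r.
have [->|/eq1 ->] := eqVneq y 0; first by rewrite addr0 oner_eq0.
rewrite /=; apply/negbTE; rewrite negbK; apply: contraT => /eq1/eqP.
by rewrite -subr_eq0 addrK oner_eq0.
Qed.

(** Boolean form of the case [n = 4], [N = 8] with cycle length 16, [b i] standing for [V i != 0].
    The conclusion contradicts the zero just before the cycle closes. *)
Lemma LFSR4_incompatible (b : nat -> bool) (c0 c1 c2 c3 : bool) (e : nat) :
  (e < 4)%N -> b 0%N = false -> b 1%N = false -> b 2%N = false -> b 3%N ->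
  b 14%N ->
  (forall i, (i < 8)%N -> b (i + 8)%N = b i (+) (i %% 4 == e)%N) ->
  (forall i, (i < 11)%N ->
    b (i + 4)%N = c0 && b i (+) (c1 && b i.+1 (+)
                  (c2 && b i.+2 (+) c3 && b i.+3))) ->
  b 15%N.
Proof.
move=> lte b0 b1 b2 b3 b14 diff rec.
have d0 : b 8%N = b 0%N (+) (0 == e)%N := diff 0%N isT.
have d1 : b 9%N = b 1%N (+) (1 == e)%N := diff 1%N isT.
have d2 : b 10%N = b 2%N (+) (2 == e)%N := diff 2%N isT.
have d3 : b 11%N = b 3%N (+) (3 == e)%N := diff 3%N isT.
have d4 : b 12%N = b 4%N (+) (0 == e)%N := diff 4%N isT.
have d5 : b 13%N = b 5%N (+) (1 == e)%N := diff 5%N isT.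
have d6 : b 14%N = b 6%N (+) (2 == e)%N := diff 6%N isT.
have d7 : b 15%N = b 7%N (+) (3 == e)%N := diff 7%N isT.
have r0 : b 4%N = _ := rec 0%N isT. have r1 : b 5%N = _ := rec 1%N isT.
have r2 : b 6%N = _ := rec 2%N isT. have r3 : b 7%N = _ := rec 3%N isT.
have r4 : b 8%N = _ := rec 4%N isT. have r5 : b 9%N = _ := rec 5%N isT.
have r6 : b 10%N = _ := rec 6%N isT. have r7 : b 11%N = _ := rec 7%N isT.
have r8 : b 12%N = _ := rec 8%N isT. have r9 : b 13%N = _ := rec 9%N isT.
have r10 : b 14%N = _ := rec 10%N isT.
move: r0 r1 r2 r3 r4 r5 r6 r7 r8 r9 r10
  d0 d1 d2 d3 d4 d5 d6 d7.
rewrite b0 b1 b2 b3 b14 /= => {diff rec b0 b1 b2 b3 b14}.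
case: e lte => [|[|[|[|//]]]] _; case: c0 c1 c2 c3 => -[] [] [] /=.
(* For fixed coefficients, [r0] to [r9] compute [b 4] to [b 13]. What remains are constraints
   between known bits, and [d7], which gives [b 15]. *)
all: do 10?[move=> -> /=]; by do 9?[move=> // -> /=].
Qed.

(** The last hypothesis says that the range is too short for [LFSR_coef_eq0]. It amounts to
    [(a - 1) * a ^ n.-1 <= 2 * n], which exponential growth rules out except for small values. *)
Lemma sparse_difference_exceptions (a n : nat) : (1 < a)%N -> (1 < n)%N ->
  (n %| a ^ n.-1)%N -> ((a * a ^ n.-1).-1 < a ^ n.-1 + 2 * n)%N ->
  a = 2%N /\ (n = 2%N \/ n = 4%N).
Proof.
case: a n => [|[|[|a]]] // [|[|m]] // _ _; last first.
  suff : (2 * m.+1 < a.+3 ^ m.+1)%N by rewrite /=; nia.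
  elim: m => // m IHm; rewrite expnS; nia.
case: m => [|[|[|m]]] // _; [by split; auto | by split; auto |].
suff : (2 * m.+1.+4 < 2 ^ m.+4)%N by rewrite /=; lia.
elim: m => // m IHm; rewrite expnS; lia.
Qed.

(** Here index 0 is the position after the first 0 of the run, that is, after the deleted letter.
    The other [n.-1] zeros of the run open [V], and the deleted one sits at the last index of a
    period. *)
Lemma debruijn_sparse_difference (F : finFieldType) (n N e : nat) (V : nat -> F)
    (c : 'I_n -> F) : (1 < n)%N -> (e < n)%N -> (n %| N)%N ->
  N = (#|F| ^ n.-1)%N ->
  (forall i, V (i + #|F| * N)%N = V i) ->
  (forall i j, (forall k, (k < n)%N -> V (i + k)%N = V (j + k)%N) ->
     i = j %[mod #|F| * N]) ->
  (forall y : nat -> F, exists2 i, (i < #|F| * N)%N &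
     forall k, (k < n)%N -> V (i + k)%N = y k) ->
  (forall i, (V (i + N)%N != V i) = (i %% n == e)%N) ->
  (forall k, (k < n)%N -> V ((#|F| * N).-1 + k)%N = 0) ->
  ~ (forall i, (i + n < (#|F| * N).-1)%N ->
       V (i + n)%N = \sum_(j < n) c j * V (i + j)%N).
Proof.
move=> n1 lten dvdnN defN; set M := (#|F| * N)%N => VM Vinj Vsurj VN Vz rec.
have F1 : (1 < #|F|)%N by exact: card_finNzRing_gt1.
have leNM : (2 * N <= M)%N by rewrite leq_mul2r F1 orbT.
have leN : (n <= N)%N by rewrite dvdn_leq // defN expn_gt0 ltnW.
have M3 : (3 < M)%N by lia.
have Vlast : V M.-1 = 0 by rewrite -[M.-1]addn0 Vz // ltnW.
have Vinit i : (i < n.-1)%N -> V i = 0.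
  by move=> lti; rewrite -VM -[RHS](Vz i.+1); [congr V | ]; lia.
(* The letters on either side of the zero run are nonzero, since otherwise [0^n] would occur a
   second time. *)
have Vn1 : V n.-1 != 0.
  apply/eqP => Vn; suff : M.-1 = 0 %[mod M] by rewrite mod0n modn_small; lia.
  apply: Vinj => k ltk; rewrite Vz // add0n.
  have [/Vinit -> //|lek] := ltnP k n.-1.
  by rewrite (_ : k = n.-1) //; lia.
have VM2 : V M.-2 != 0.
  apply/eqP => Vn; suff : M.-1 = M.-2 %[mod M] by rewrite !modn_small; lia.
  apply: Vinj => -[|k] ltk; first by rewrite !addn0 Vlast.
  by rewrite Vz // (_ : M.-2 + k.+1 = M.-1 + k)%N ?Vz //; lia.
have [ltM|geM] := leqP (N + 2 * n) M.-1.
  have supp := LFSR_sparse_support n1 Vinit (LFSR_coef_eq0 lten ltM VN rec) rec.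
  (* As [n > 1], the all-ones word has nonzero letters at the adjacent indices [i] and [i.+1], which
     cannot be congruent modulo [n]. *)
  have [i ltiM V1] := Vsurj (fun=> 1).
  have Vi : V i != 0 by rewrite -[i]addn0 V1 ?oner_eq0 // ltnW.
  have Vi1 : V i.+1 != 0 by rewrite -addn1 V1 ?oner_eq0.
  have i1 : (i.+1 < M.-1)%N.
    have iM1 : i != M.-1 by apply: contraNneq Vi => ->; rewrite Vlast.
    suff : i.+1 != M.-1 by lia.
    by apply: contraNneq Vi1 => ->; rewrite Vlast.
  have := supp _ i1 Vi1; rewrite -(supp _ (ltnW i1) Vi) => /eqP.
  by rewrite -addn1 -{2}[i]addn0 eqn_modDl mod0n modn_small.
have [F2 [n2|n4]] : #|F| = 2%N /\ (n = 2 \/ n = 4)%N.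
  by apply: sparse_difference_exceptions; rewrite // -defN.
- subst n; have {}defN : N = 2%N by rewrite defN F2.
  have defM : M = 4%N by rewrite /M F2 defN.
  have V2 : V 2%N != 0 by rewrite -[2%N]/(4.-2) -defM.
  have V3 : V 3%N = 0 by rewrite -[3%N]/(4.-1) -defM.
  (* One period is zero, nonzero, nonzero, zero. Thus [V] changes both from 0 to 2 and from 1 to 3,
     though only one class modulo 2 allows a change. *)
  have := VN 1%N; have := VN 0%N; rewrite defN (Vinit 0%N) // V2.
  move=> /esym/eqP <-.
  by rewrite V3 eq_sym Vn1.
- subst n; have {}defN : N = 8%N by rewrite defN F2.
  have defM : M = 16%N by rewrite /M F2 defN.
  have neq (x y : F) : (x != 0) = (y != 0) (+) (x != y).
    by rewrite -[x in LHS](subrK y) card2_addr_neq0 // addbC subr_eq0.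
  have /negP : ~~ (V M.-1 != 0) by rewrite Vlast eqxx.
  rewrite defM; apply.
  apply: (@LFSR4_incompatible (fun i => V i != 0) (c ord0 != 0)
    (c (lift ord0 ord0) != 0) (c (lift ord0 (lift ord0 ord0)) != 0)
    (c (lift ord0 (lift ord0 (lift ord0 ord0))) != 0) e) => //.
  + by rewrite Vinit ?eqxx.
  + by rewrite Vinit ?eqxx.
  + by rewrite Vinit ?eqxx.
  + by move: VM2; rewrite defM.
  + by move=> i _; rewrite (neq _ (V i)) -defN VN.
  + move=> i lti; rewrite rec; last by lia.
    rewrite !big_ord_recl big_ord0 addr0 !card2_addr_neq0 // !mulf_eq0 !negb_or.
    by rewrite addn0 -(addn3 i) -(addn2 i) -(addn1 i).
Qed.

(* From a lift to its difference sequence *)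
Local Close Scope ring_scope.

Theorem corollary7p20 (p k : nat) (F : finFieldType) (hp : prime p)
    (hF : #|F| = p ^ k) (n : nat) (hn : 1 < n) (u : pword F)
    (hu : upcycle n u) (hd : has_diamondicity n u 1) :
  forall w : seq F, debruijn_lift n 1 u w -> ~ obtained_by_LFSR n w.
Proof.
move=> w [/debruijnP[w_ex w_inj w_size] cov] [c rec].
have F1 : 1 < #|F| := card_finNzRing_gt1 F.
have w0 : 0 < size w by rewrite w_size expn_gt0 ltnW.
rewrite expn1 in cov; have {cov}[] := cyc_coversP 0%R (ltnW F1) w0 cov.
set N := size u => w_sizeN [r wu].
have defN : N = #|F| ^ n.-1.
  apply/eqP; rewrite -(eqn_pmul2l (ltnW F1)) -w_sizeN w_size -expnS.
  by rewrite prednK // ltnW.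
have u0 : 0 < size u by rewrite -/N defN expn_gt0 ltnW.
have ltz : zero_run n w < size w.
  rewrite -[X in _ < X](size_iota 0) -has_find; apply/hasP.
  have [i lti wi] := w_ex (fun=> 0%R); exists i; first by rewrite mem_iota.
  apply/eqP/(@eq_from_nth _ 0%R); rewrite size_mkseq ?size_nseq // => k0 ltk.
  by rewrite nth_mkseq // nth_nseq ltk wi.
have wz k0 : k0 < n -> cyc 0%R w (zero_run n w + k0) = 0%R.
  move=> ltk; have := ltz; rewrite -{1}[X in _ < X](size_iota 0) -has_find.
  move=> wz.
  have /eqP := nth_find 0 wz; rewrite nth_iota // add0n.
  by move/(congr1 (nth 0%R ^~ k0)); rewrite nth_mkseq // nth_nseq ltk.
have cyc_mod := @cyc_modified _ _ _ _ ltz.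
move: (zero_run n w) => z in ltz wz cyc_mod *.
have dia : one_per_window n (fun i => cyc None u (z.+1 + i + r) == None).
  move=> i; rewrite -[RHS](diamond_one_per_window u0 hd (z.+1 + i + r)).
  by apply: eq_bigr => j _; rewrite addnA addnAC.
have [e lten {}dia] := one_per_windowP dia.
(* The diamonds have period [N] and fill exactly one class modulo [n], so a shift by [N] preserves
   that class. *)
have dvdnN : n %| N.
  have := dia (e + N); rewrite addnA addnAC cycDsize dia modn_small // eqxx.
  move/esym; rewrite -{2}(modn_small lten) -{2}[e]addn0 eqn_modDl mod0n.
  by rewrite /dvdn.
(* Away from the diamonds, both positions carry the same letter of [u]. *)
have Vnd i : i %% n != e ->
    cyc 0%R w (z.+1 + (i + N)) = cyc 0%R w (z.+1 + i).
  rewrite -dia => nd; have [E|E] := wu (z.+1 + i); first by rewrite E in nd.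
  apply: Some_inj; rewrite -E; have := wu (z.+1 + (i + N)).
  by rewrite addnA addnAC cycDsize => -[N0|//]; rewrite N0 in nd.
apply: (@debruijn_sparse_difference F n N e (fun i => cyc 0%R w (z.+1 + i)) c)
  => //; rewrite -?w_sizeN.
- by move=> i; rewrite addnA cycDsize.
- move=> i j E; apply/eqP; rewrite -(eqn_modDl z.+1); apply/eqP/w_inj.
  by apply/window_eqP => k0 ltk; rewrite -!addnA E.
- move=> y; have [i lti wi] := w_ex y.
  (* This index compensates for the origin [z.+1] of [V]. *)
  exists ((i + (size w - z.+1)) %% size w) => [|k0 ltk].
    by rewrite ltn_mod.
  rewrite -wi // /cyc addnA -modnDml modnDmr addnCA subnKC // modnDr.
  by rewrite modnDml.
- move=> i; have [ie|] := eqVneq (i %% n) e; last by move/Vnd ->; rewrite eqxx.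
  (* If the letters at a diamond agreed, then so would the two whole windows, whose other [n.-1]
     positions are not diamonds. But [0 < N < size w], so the positions are distinct. *)
  apply/eqP => Vi; have /w_inj/eqP : window 0%R n w (z.+1 + (i + N))
    = window 0%R n w (z.+1 + i).
    apply/window_eqP => -[|k0] ltk; first by rewrite !addn0.
    rewrite -!addnA [N + _]addnC [i + (_ + _)]addnA Vnd //.
    by rewrite -ie -{2}[i]addn0 eqn_modDl mod0n modn_small.
  rewrite eqn_modDl -{2}[i]addn0 eqn_modDl mod0n modn_small.
    by rewrite -/N defN -leqn0 leqNgt expn_gt0 ltnW.
  by rewrite w_sizeN -{1}[N]mul1n ltn_mul2r F1 u0.
- move=> k0 ltk; rewrite -[RHS](wz _ ltk) -[RHS]cycDsize; congr cyc.
  by rewrite -[in RHS](prednK w0) addSn addnS (addnC _ k0) addnA.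
(* The recurrence passes from the modified word to [w] as long as its highest index stays short of
   the deleted zero. *)
- move=> i lti; have := rec (z + i); rewrite -addnA !cyc_mod // => ->.
  apply: eq_bigr => j _; rewrite -addnA cyc_mod //.
  by apply: ltn_trans lti; rewrite ltn_add2l ltn_ord.
Qed.
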